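(* Let $\mathcal G$ be a connected compact metric graph, let $\mathcal V^D\subseteq\mathcal V$ be a nonempty set of degree-one vertices, and let $1<p<\infty$. Let $c\mathcal G$ denote the metric graph obtained from $\mathcal G$ by multiplying every edge length by a factor $c>0$, while keeping the same Dirichlet set $\mathcal V^D$. Then $$T_p(c\mathcal G,\mathcal V^D)=c^{2p-1}\,T_p(\mathcal G,\mathcal V^D).$$
   Context: A compact metric graph $\mathcal G$ is obtained from a finite combinatorial graph with vertex set $\mathcal V$ and finite edge set $\mathcal E$ by identifying the endpoints of compact intervals $[0,\ell_e]$, $\ell_e>0$, $e\in\mathcal E$, according to the graph structure; $|\mathcal G|=\sum_{e}\ell_e$. $\mathcal E_v$ is the set of edges incident with $v$ (a loop at $v$ counted twice, once for each endpoint) and $\deg(v)=|\mathcal E_v|$. Set $\mathcal V^N=\mathcal V\setminus\mathcal V^D$. $u_e$ denotes the restriction of $u$ to $e$. $W^{1,p}(\mathcal G)$ is the space of $u:\mathcal G\to\mathbb R$ with $u|_e\in W^{1,p}(0,\ell_e)$ for all $e\in\mathcal E$ and $u$ continuous at every vertex; $W^{1,p}_{\mathcal V^D}(\mathcal G)=\{u\in W^{1,p}(\mathcal G): u(v)=0\ \forall v\in\mathcal V^D\}$. Integrals over $\mathcal G$ are sums of integrals over edges. The $p$-torsion function $w_p$ is the unique function in $W^{1,p}_{\mathcal V^D}(\mathcal G)$ with $-(|w_{p,e}'|^{p-2}w_{p,e}')'=1$ on each edge $e$, $w_p(v)=0$ for $v\in\mathcal V^D$, and $\sum_{e\in\mathcal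 E_v}|w_{p,e}'(v)|^{p-2}\partial_{\nu_e}w_{p,e}(v)=0$ for $v\in\mathcal V^N$, where $\partial_{\nu_e}$ is the derivative at $v$ in the outward direction along $e$ (pointing from $v$ into $e$). Equivalently, $\int_{\mathcal G}|w_p'|^{p-2}w_p'\phi'\,dx=\int_{\mathcal G}\phi\,dx$ for all $\phi\in W^{1,p}_{\mathcal V^D}(\mathcal G)$. The $p$-torsional rigidity is $T_p(\mathcal G,\mathcal V^D)=\bigl(\int_{\mathcal G}w_p\,dx\bigr)^{p-1}$. *)

(* Defs.v *)
From HB Require Import structures.
From mathcomp Require Import all_boot all_order all_algebra.
From mathcomp Require Import all_classical all_reals all_analysis.

Set Implicit Arguments.
Unset Strict Implicit.
Unset Printing Implicit Defensive.

Import Order.TTheory GRing.Theory Num.Theory.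
Import numFieldNormedType.Exports.

Local Open Scope classical_set_scope.
Local Open Scope ring_scope.

(* Loops and multiple edges are allowed.  The edge [e] is parametrized by the
   interval [0, len e], with 0 glued to [src e] and [len e] glued to [tgt e]. *)
Record metric_graph (R : realType) := MetricGraph {
  vert : finType;
  edge : finType;
  src : edge -> vert;
  tgt : edge -> vert;
  len : edge -> R;
  len_gt0 : forall e, 0 < len e }.

Section MetricGraphs.
Variable R : realType.
Implicit Types (G : metric_graph R) (l p : R).

(* An end of an edge is [(e, false)] (the endpoint 0) or [(e, true)] (the
   endpoint [len e]); the ends located at [v] form the set E_v, in which a loop
   occurs twice. *)
Definition end_vert G (h : edge G * bool) : vert G :=
  if h.2 then tgt h.1 else src h.1.

Definition end_pos G (h : edge G * bool) : R := if h.2 then len h.1 else 0.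

Definition ends_at G (v : vert G) : {set edge G * bool} :=
  [set h | end_vert h == v]%SET.

Definition deg G (v : vert G) : nat := #|ends_at v|.

Definition adj G : rel (vert G) := fun v w =>
  [exists e : edge G, (src e == v) && (tgt e == w)
                   || (src e == w) && (tgt e == v)].

Definition connected_graph G : Prop := forall v w : vert G, connect (@adj G) v w.

Definition scale_graph (c : R) (c_gt0 : 0 < c) G : metric_graph R :=
  @MetricGraph R (vert G) (edge G) (@src R G) (@tgt R G)
    (fun e => c * len e) (fun e => mulr_gt0 c_gt0 (len_gt0 e)).

(* Test functions of class C^1_c on the open interval (0, l). *)
Definition test_fun l (phi : R -> R) : Prop :=
  [/\ forall x, derivable phi x 1,
      continuous phi^`()%classic &
      exists a b : R, [/\ 0 < a, b < l & forall x, phi x != 0 -> a <= x <= b]].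

Definition in_Lp p l (f : R -> R) : Prop :=
  measurable_fun `]0, l[ f /\
  (@lebesgue_measure R).-integrable `]0, l[ (fun x => (`|f x| `^ p)%:E).

Definition weak_derivative l (u g : R -> R) : Prop :=
  forall phi, test_fun l phi ->
    \int[@lebesgue_measure R]_(x in `]0, l[) (u x * phi^`()%classic x) =
    - \int[@lebesgue_measure R]_(x in `]0, l[) (g x * phi x).

Definition W1p_itv p l (u : R -> R) : Prop :=
  in_Lp p l u /\ exists g, in_Lp p l g /\ weak_derivative l u g.

(* A function on G is a family [u e], e an edge, of which only the values on
   [0, len e] matter, and which agree at identified endpoints.  Each component
   is the continuous representative of its W^{1,p} class. *)
Definition W1p G p (u : edge G -> R -> R) : Prop :=
  [/\ forall e, W1p_itv p (len e) (u e),
      forall e, {within `[0, len e], continuous (u e)} &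
      forall h k : edge G * bool, end_vert h = end_vert k ->
        u h.1 (end_pos h) = u k.1 (end_pos k)].

Definition W1p_dirichlet G (VD : {set vert G}) p (u : edge G -> R -> R) : Prop :=
  W1p p u /\
  forall v, v \in VD -> forall h, h \in ends_at v -> u h.1 (end_pos h) = 0.

Definition graph_integral G (u : edge G -> R -> R) : R :=
  \sum_(e : edge G) \int[@lebesgue_measure R]_(x in `[0, len e]) u e x.

Definition outward_derivative G (g : edge G -> R -> R) (h : edge G * bool) : R :=
  if h.2 then - g h.1 (end_pos h) else g h.1 (end_pos h).

(* The derivative w' is taken in the weak sense; [g e] is its representative on
   the edge [e] that is continuous up to the endpoints, which gives a meaning to
   the values of w' at the vertices. *)
Definition is_torsion_function G (VD : {set vert G}) p
    (w : edge G -> R -> R) : Prop :=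
  W1p_dirichlet VD p w /\
  exists g : edge G -> R -> R,
    [/\ forall e, {within `[0, len e], continuous (g e)},
        forall e, weak_derivative (len e) (w e) (g e),
        forall e, weak_derivative (len e)
          (fun x => `|g e x| `^ (p - 2) * g e x) (fun=> -1) &
        forall v, v \notin VD ->
          \sum_(h in ends_at v)
            `|g h.1 (end_pos h)| `^ (p - 2) * outward_derivative g h = 0].

Definition torsion_function G (VD : {set vert G}) p : edge G -> R -> R :=
  xget (fun _ _ => 0) [set w | is_torsion_function VD p w].

Definition torsional_rigidity G (VD : {set vert G}) p : R :=
  graph_integral (torsion_function VD p) `^ (p - 1).

End MetricGraphs.

(* Main.v *)
(* If w is a torsion function of G with derivative g, then
   c^(p/(p-1)) w(x/c) is one of the scaled graph, with derivative
   c^(1/(p-1)) g(x/c), and changing variables in its integral gives the factor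
   c^(p/(p-1) + 1), whose (p-1)-th power is c^(2p-1).
     As the torsion function is a chosen one, this needs uniqueness on [0, len e].
   By the du Bois-Reymond lemma the weak equations are classical: w' = g and
   flux(g)' = -1, where flux(y) = |y|^(p-2) y.  For two solutions, the
   difference of the fluxes is a constant a_e on each edge, and Kirchhoff's
   condition gives sum_e a_e [w1 - w2]_e = 0, where [.]_e is the increment along
   e.  All terms are nonnegative as flux is increasing, hence vanish, so w1 - w2
   is constant on edges, and connectedness propagates the Dirichlet value 0.
     Existence plays no role: scaling is invertible, so if one of the graphs has
   no torsion function then neither has the other, and both rigidities are 0. *)

Require Import Defs.
From HB Require Import structures.
From mathcomp Require Import all_boot all_order all_algebra.
From mathcomp Require Import all_classical all_reals all_analysis.
From mathcomp Require Import measurable_realfun ring lra.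

Import Order.TTheory GRing.Theory Num.Theory.
Local Open Scope ring_scope.

(** * Antiderivatives on closed intervals *)

Section Primitives.
Set Implicit Arguments.
Unset Strict Implicit.
Unset Printing Implicit Defensive.
Import numFieldNormedType.Exports.
Local Open Scope classical_set_scope.
Variable R : realType.
Implicit Types (l c x y : R) (F f g u v : R -> R).

Notation mu := (@lebesgue_measure R).

Lemma near_itvoo (a b x : R) : a < x < b -> \forall y \near x, a < y < b.
Proof.
move=> axb; have : x \in `]a, b[%R by rewrite in_itv.
by move=> /near_in_itvoo; apply: filterS => y; rewrite in_itv.
Qed.

(** Continuity of [f] up to the ends gives a meaning to [f 0] and [f l], as Kirchhoff's condition
    requires. The values of [F] and [f] outside [[0, l]] do not matter. *)
Definition primitive_on l F f : Prop :=
  [/\ {within `[0, l], continuous F}, {within `[0, l], continuous f} &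
      forall x, 0 < x < l -> is_derive x 1 F (f x)].

Lemma continuous_integrable l f : {within `[0, l], continuous f} ->
  mu.-integrable `[0, l] (EFin \o f).
Proof.
by move=> cf; apply: continuous_compact_integrable => //; exact: segment_compact.
Qed.

Lemma Rintegral_oo_cc l f : {within `[0, l], continuous f} ->
  \int[mu]_(x in `]0, l[) f x = \int[mu]_(x in `[0, l]) f x.
Proof.
move=> /continuous_integrable fi.
rewrite Rintegral_itv_bndo_bndc; last first.
  by apply: integrableS fi => //; exact: subset_itv_oo_cc.
rewrite Rintegral_itv_obnd_cbnd //.
by apply: integrableS fi => //; exact: subset_itv_oc_cc.
Qed.

Lemma within_continuousP l f x : {within `[0, l], continuous f} ->
  0 < x < l -> {for x, continuous f}.
Proof.
move=> cf xl; have l0 : 0 < l by case/andP: xl; exact: lt_trans.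
by apply: within_continuous_continuous cf _ => //; rewrite in_itv.
Qed.

Lemma within_continuous_scale l c f : 0 < l -> 0 < c ->
  {within `[0, l], continuous f} ->
  {within `[0, c * l], continuous (fun x => f (x / c))}.
Proof.
move=> l0 c0 /subspace_continuousP cf; apply/subspace_continuousP => x.
rewrite /= in_itv /= => /andP[x0 xl].
have xcl : `[0, l] (x / c).
  rewrite /= in_itv /=; apply/andP; split; first by rewrite divr_ge0 // ltW.
  by rewrite ler_pdivrMr // mulrC.
apply: cvg_trans (cf _ xcl) => A /= [e e0 eA].
exists (e * c) => /=; first by rewrite mulr_gt0.
move=> y /= xy; rewrite in_itv /= => /andP[y0 yl]; apply: eA => /=.
  rewrite -mulrBl normrM [`|c^-1|]gtr0_norm ?invr_gt0 //.
  by rewrite ltr_pdivrMr.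
rewrite in_itv /=; apply/andP; split; first by rewrite divr_ge0 // ltW.
by rewrite ler_pdivrMr // mulrC.
Qed.

Lemma primitive_exists l f : 0 < l -> {within `[0, l], continuous f} ->
  exists F, primitive_on l F f.
Proof.
move=> l0 cf; have fi := continuous_integrable cf.
exists (fun x => \int[mu]_(t in `[0, x]) f t); split => //.
  exact: parameterized_integral_continuous (ltW l0) fi.
move=> x /andP[x0 xl].
have [dF F'] := continuous_FTC1_closed xl fi x0
  (within_continuousP cf (introT andP (conj x0 xl))).
by apply: DeriveDef; [exact: dF|rewrite -derive1E].
Qed.

Lemma FTC_primitive l F f : 0 < l -> primitive_on l F f ->
  \int[mu]_(x in `[0, l]) f x = F l - F 0.
Proof.
move=> l0 [cF cf dF].
rewrite /Rintegral (continuous_FTC2 l0 cf (F := F)) //.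
- have /(continuous_within_itvP _ l0)[_ F0 Fl] := cF.
  split => // x; rewrite in_itv /= => xl.
  by have := dF x xl; exact: @ex_derive.
- move=> x; rewrite in_itv /= => xl.
  by have ? := dF x xl; rewrite derive1E derive_val.
Qed.

Lemma primitiveD l F f G g : primitive_on l F f -> primitive_on l G g ->
  primitive_on l (fun x => F x + G x) (fun x => f x + g x).
Proof.
move=> [cF cf dF] [cG cg dG]; split.
- by move=> x; apply: cvgD; [exact: cF|exact: cG].
- by move=> x; apply: cvgD; [exact: cf|exact: cg].
- by move=> x xl; exact: (is_deriveD (dF x xl) (dG x xl)).
Qed.

Lemma primitiveM l F f G g : primitive_on l F f -> primitive_on l G g ->
  primitive_on l (fun x => F x * G x) (fun x => f x * G x + F x * g x).
Proof.
move=> [cF cf dF] [cG cg dG]; split.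
- by move=> x; apply: cvgM; [exact: cF|exact: cG].
- move=> x; apply: cvgD.
    by apply: cvgM; [exact: cf|exact: cG].
  by apply: cvgM; [exact: cF|exact: cg].
- move=> x xl; apply: is_derive_eq.
    exact: (is_deriveM (dF x xl) (dG x xl)).
  by rewrite /GRing.scale /=; ring.
Qed.

Lemma primitive_cst l k : primitive_on l (fun=> k) (fun=> 0).
Proof. by split => [x|x|x _]; [exact: cvg_cst|exact: cvg_cst|exact: is_derive_cst]. Qed.

Lemma primitiveZ l k F f : primitive_on l F f ->
  primitive_on l (fun x => k * F x) (fun x => k * f x).
Proof.
move=> Ff; have := primitiveM (primitive_cst l k) Ff.
by under [in X in primitive_on _ _ X]eq_fun do rewrite mul0r add0r.
Qed.

Lemma primitiveB l F f G g : primitive_on l F f -> primitive_on l G g ->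
  primitive_on l (fun x => F x - G x) (fun x => f x - g x).
Proof.
move=> Ff /(primitiveZ (-1)) Gg; have := primitiveD Ff Gg.
under [in X in primitive_on _ X]eq_fun do rewrite mulN1r.
by under [in X in primitive_on _ _ X]eq_fun do rewrite mulN1r.
Qed.

Lemma primitive_scale l c F f : 0 < l -> 0 < c -> primitive_on l F f ->
  primitive_on (c * l) (fun x => F (x / c)) (fun x => f (x / c) / c).
Proof.
move=> l0 c0 [cF cf dF]; split.
- exact: within_continuous_scale.
- move=> x; apply: cvgM; last exact: cvg_cst.
  exact: (within_continuous_scale l0 c0 cf).
- move=> x /andP[x0 xl].
  have xc : 0 < x / c < l.
    by rewrite divr_gt0 //= ltr_pdivrMr // mulrC.
  have dc : is_derive x 1 (fun y => y / c) c^-1.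
    apply: is_derive_eq.
    by rewrite /GRing.scale /= mulr0 add0r mulr1.
  exact: (@is_derive1_comp _ F (fun y => y / c) x _ _ (dF _ xc) dc).
Qed.

Lemma primitive_MVT l F f x y : primitive_on l F f -> 0 <= x -> x < y -> y <= l ->
  exists2 z, x < z < y & F y - F x = f z * (y - x).
Proof.
move=> [cF _ dF] x0 xy yl.
have [|| z] := @MVT _ F f _ _ xy.
- move=> z; rewrite in_itv /= => /andP[xz zy]; apply: dF.
  by rewrite (le_lt_trans x0 xz) (lt_le_trans zy yl).
- apply: continuous_subspaceW cF => z /=; rewrite !in_itv /= => /andP[xz zy].
  by rewrite (le_trans x0 xz) (le_trans zy yl).
- by rewrite in_itv /=; exists z.
Qed.

Lemma primitive0_cst l F f x : primitive_on l F f ->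
  (forall y, 0 < y < l -> f y = 0) -> 0 <= x <= l -> F x = F 0.
Proof.
move=> Ff f0 /andP[]; rewrite le_eqVlt => /predU1P[<- //|x0 xl].
have [z /andP[z0 zx]] := primitive_MVT Ff (lexx 0) x0 xl.
rewrite f0 ?mul0r => [/eqP|]; first by rewrite subr_eq0 => /eqP.
by rewrite z0 (lt_le_trans zx xl).
Qed.

(** A nondecreasing [F] with equal end values is constant, so its derivative is zero. This serves as
    the principle that a nonnegative continuous function with zero integral vanishes. *)
Lemma primitive_ge0_eq0 l F f : primitive_on l F f ->
  (forall x, 0 < x < l -> 0 <= f x) -> F l = F 0 ->
  forall x, 0 < x < l -> f x = 0.
Proof.
move=> Ff f0 Fl x xl; have Fx y : 0 < y < l -> F y = F 0.
  move=> /andP[y0 yl]; apply/eqP; rewrite eq_le.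
  have [z /andP[z0 zy] Fz] := primitive_MVT Ff (lexx 0) y0 (ltW yl).
  have [t /andP[yt tl] Ft] := primitive_MVT Ff (ltW y0) yl (lexx l).
  apply/andP; split.
    rewrite -Fl -subr_ge0 Ft mulr_ge0 ?subr_ge0 ?(ltW yl) // f0 // tl andbT.
    exact: lt_trans yt.
  by rewrite -subr_ge0 Fz mulr_ge0 ?subr_ge0 ?(ltW y0) // f0 // z0 (lt_trans zy).
have [_ _ /(_ x xl) dF] := Ff.
have : is_derive x 1 F 0.
  apply: near_eq_is_derive (is_derive_cst (F 0) x 1).
  apply: filterS (near_itvoo xl) => y yl.
  by rewrite Fx.
by move=> dF0; rewrite -[LHS](@derive_val _ _ _ _ _ _ _ dF) derive_val.
Qed.

End Primitives.

(** * Weak derivatives and their agreement with classical ones *)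

Section WeakDerivative.
Set Implicit Arguments.
Unset Strict Implicit.
Unset Printing Implicit Defensive.
Import numFieldNormedType.Exports.
Local Open Scope classical_set_scope.
Variable R : realType.
Implicit Types (l x y : R) (F f g u v phi : R -> R).

Notation mu := (@lebesgue_measure R).

Lemma test_fun_primitive l phi : test_fun l phi -> primitive_on l phi phi^`().
Proof.
move=> [dphi cphi _]; split; first last.
- by move=> x _; apply: DeriveDef; [exact: dphi|rewrite -derive1E].
- exact: continuous_subspaceT.
- apply: continuous_subspaceT => x; apply: differentiable_continuous.
  exact/derivable1_diffP.
Qed.

Lemma test_fun_ends l phi : test_fun l phi -> phi 0 = 0 /\ phi l = 0.
Proof.
move=> [_ _ [a [b [a0 bl phi0]]]]; split; apply/eqP/negPn/negP => /phi0.
  by rewrite leNgt a0.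
by rewrite [l <= b]leNgt bl andbF.
Qed.

Lemma within_continuousM l f g :
  {within `[0, l], continuous f} -> {within `[0, l], continuous g} ->
  {within `[0, l], continuous (fun x => f x * g x)}.
Proof. by move=> cf cg x; apply: cvgM; [exact: cf|exact: cg]. Qed.

(** Integration by parts: the boundary terms drop out because test functions vanish at 0 and at
    [l]. *)
Lemma primitive_weak_derivative l u g : 0 < l ->
  primitive_on l u g -> weak_derivative l u g.
Proof.
move=> l0 ug phi tphi; have [_ cphi _] := tphi.
have [cu cg _] := ug; have pphi := test_fun_primitive tphi.
have [cp cp' _] := pphi.
have cgp := within_continuousM cg cp.
have cup := within_continuousM cu cp'.
rewrite !Rintegral_oo_cc //.
have := FTC_primitive l0 (primitiveM ug pphi).
have [-> ->] := test_fun_ends tphi.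
rewrite RintegralD //; [|exact: continuous_integrable..].
by rewrite !mulr0 subrr addrC => /eqP; rewrite addr_eq0 => /eqP.
Qed.

Lemma primitive_on_le l l' F f : l' <= l -> primitive_on l F f ->
  primitive_on l' F f.
Proof.
move=> l'l [cF cf dF]; have sub : `[0, l'] `<=` `[0, l]%classic.
  by move=> x /=; rewrite !in_itv /= => /andP[-> /le_trans]; exact.
split; [exact: continuous_subspaceW cF|exact: continuous_subspaceW cf|].
by move=> x /andP[x0 xl']; apply: dF; rewrite x0 (lt_le_trans xl').
Qed.

(** As [k] vanishes off []a, b[], its antiderivative [F] is constant on each side of that interval,
    and [F l = F 0] makes the two constants equal. Subtracting this constant leaves a function
    supported in [[a, b]]. *)
Lemma test_fun_of_primitive l a b F k : 0 < a -> a < b -> b < l ->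
  primitive_on l F k -> (forall x, ~~ (a < x < b) -> k x = 0) -> F l = F 0 ->
  exists2 phi, test_fun l phi & phi^`() = k.
Proof.
move=> a0 ab bl Fk k0 Fl0; have [cF ck dF] := Fk.
have al := lt_trans ab bl; have b0 := lt_trans a0 ab.
have Fa x : 0 <= x <= a -> F x = F 0.
  apply: (@primitive0_cst _ a F k); first exact: primitive_on_le (ltW al) Fk.
  by move=> y /andP[_ ya]; apply: k0; rewrite ltNge (ltW ya).
have Fb x : b <= x -> x < l -> F x = F 0.
  move=> bx xl; rewrite -Fl0; apply/esym/eqP; rewrite -subr_eq0.
  have x0 : 0 <= x by rewrite (le_trans _ bx) // ltW.
  have [z /andP[xz zl] ->] := primitive_MVT Fk x0 xl (lexx l).
  by rewrite k0 ?mul0r // negb_and -!leNgt (le_trans bx (ltW xz)) orbT.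
(* Nothing is known of [F] outside [[0, l]], whereas a test function must be C^1 on the whole line;
   hence the cutoff. *)
pose phi x := if 0 < x < l then F x - F 0 else 0.
have phi0 x : ~~ (a < x < b) -> phi x = 0.
  rewrite /phi; case: ifP => // /andP[x0 xl].
  rewrite negb_and -!leNgt => /orP[xa|bx]; last by rewrite Fb ?subrr.
  by rewrite Fa ?subrr // (ltW x0).
(* Since [0 < a] and [b < l], a whole neighbourhood of such a point misses []a, b[], so [phi] and
   [k] vanish there and the cutoff creates no kink. *)
have outside x : ~~ (0 < x < l) -> \forall y \near x, ~~ (a < y < b).
  rewrite negb_and -!leNgt => /orP[x0|lx].
    have xa : x - 1 < x < a by rewrite (le_lt_trans x0) // gtrBl ltr01.
    apply: filterS (near_itvoo xa) => y /andP[_ ya].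
    by rewrite negb_and -!leNgt (ltW ya).
  have bx : b < x < x + 1 by rewrite (lt_le_trans bl) // ltrDl ltr01.
  apply: filterS (near_itvoo bx) => y /andP[by_ _].
  by rewrite negb_and -!leNgt (ltW by_) orbT.
have dphi x : is_derive x 1 phi (k x).
  have [xl|nxl] := boolP (0 < x < l).
    have d : is_derive x 1 (F - cst (F 0)) (k x).
      by have ? := dF _ xl; apply: is_derive_eq; rewrite subr0.
    apply: near_eq_is_derive d; near=> y; rewrite /phi ifT //.
    by near: y; exact: near_itvoo.
  rewrite k0; last by apply: nbhs_singleton (outside _ nxl).
  apply: near_eq_is_derive (is_derive_cst 0 x 1); near=> y; rewrite phi0 //.
  by near: y; exact: outside.
have phi'E : phi^`() = k.
  by apply/funext => x; rewrite derive1E; have ? := dphi x; rewrite derive_val.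
exists phi => //; split.
- by move=> x; have := dphi x; exact: @ex_derive.
- rewrite phi'E => x; have [xl|nxl] := boolP (0 < x < l).
    exact: within_continuousP ck xl.
  have kx := nbhs_singleton (outside _ nxl).
  rewrite /continuous_at k0 //; apply: cvg_near_cst.
  by near=> y; apply/k0; near: y; exact: outside.
- exists a, b; split => // x; apply: contraNT; rewrite negb_and -!ltNge => h.
  apply/eqP/phi0; rewrite negb_and -!leNgt.
  by case/orP: h => /ltW ->; rewrite ?orbT.
Unshelve. all: by end_near. Qed.

(* Du Bois-Reymond: test against the [phi] with [phi' = t (v - m)], where [t] is
   a bump on [a, b] and [m] the [t]-weighted mean of [v], to get
   [\int t (v - m)^2 = 0]. *)
Lemma weak_derivative0_cst l v : 0 < l -> {within `[0, l], continuous v} ->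
  (forall phi, test_fun l phi -> \int[mu]_(x in `]0, l[) (v x * phi^`()%classic x) = 0) ->
  forall x y, 0 < x < l -> 0 < y < l -> v x = v y.
Proof.
move=> l0 cv v0 x y /andP[x0 xl] /andP[y0 yl].
(* Midpoints, chosen so that both [x] and [y] lie in []a, b[] while [[a, b]] stays inside []0,
   l[]. *)
pose a := Num.min x y / 2; pose b := (Num.max x y + l) / 2.
have a0 : 0 < a by rewrite divr_gt0 // lt_min x0.
have [ax ay] : a < x /\ a < y.
  have : Num.min x y <= x by rewrite ge_min lexx.
  have : Num.min x y <= y by rewrite ge_min lexx orbT.
  by rewrite /a; split; lra.
have [xb yb] : x < b /\ y < b.
  have : x <= Num.max x y by rewrite le_max lexx.
  have : y <= Num.max x y by rewrite le_max lexx orbT.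
  by rewrite /b; split; lra.
have bl : b < l.
  have : Num.max x y < l by rewrite gt_max xl.
  by rewrite /b; lra.
(* The quadratic [z] is positive exactly on []a, b[], and [t] is twice its positive part. *)
pose z s := (s - a) * (b - s).
pose t s := z s + `|z s|.
have t_ge0 s : 0 <= t s by rewrite /t -lerBlDl sub0r -[`|z s|]normrN ler_norm.
have t_gt0 s : a < s < b -> 0 < t s.
  move=> /andP[as_ sb]; have zs : 0 < z s by rewrite mulr_gt0 ?subr_gt0.
  by rewrite /t addr_gt0 ?normr_gt0 ?gt_eqF.
have t0 s : ~~ (a < s < b) -> t s = 0.
  move=> h; have zs : z s <= 0.
    move: h; rewrite negb_and -!leNgt => /orP[sa|bs].
      by rewrite mulr_le0_ge0 ?subr_ge0 ?subr_le0 // (le_trans sa) // ltW // (lt_trans ax).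
    by rewrite mulr_ge0_le0 ?subr_ge0 ?subr_le0 // (le_trans _ bs) // ltW // (lt_trans ax).
  by rewrite /t ler0_norm // subrr.
have ct : continuous t.
  have cz : continuous z.
    move=> s; apply: cvgM; apply: cvgB; first [exact: cvg_id|exact: cvg_cst].
  by move=> s; apply: cvgD; [exact: cz|apply: cvg_norm; exact: cz].
have ct' : {within `[0, l], continuous t} by exact: continuous_subspaceT.
have [T Tt] := primitive_exists l0 ct'.
have [V Vtv] := primitive_exists l0 (within_continuousM ct' cv).
have T_neq : T l - T 0 != 0.
  apply/eqP => /eqP; rewrite subr_eq0 => /eqP Tl0.
  have xl0 : 0 < x < l by rewrite x0.
  have := primitive_ge0_eq0 Tt (fun s _ => t_ge0 s) Tl0 xl0.
  by apply/eqP; rewrite gt_eqF // t_gt0 // ax.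
pose m := (V l - V 0) / (T l - T 0).
pose k s := t s * v s - m * t s.
have Pk := primitiveB Vtv (primitiveZ m Tt).
have [||phi tphi phi'] := test_fun_of_primitive a0 (lt_trans ax xb) bl Pk.
- by move=> s /t0 ->; rewrite mul0r mulr0 subrr.
- by rewrite /m; field.
have ck : {within `[0, l], continuous k} by case: Pk.
have [P Pvk] := primitive_exists l0 (within_continuousM cv ck).
have Pl0 : P l - P 0 = 0.
  have := v0 _ tphi; rewrite phi' Rintegral_oo_cc; last by case: Pvk.
  by rewrite (FTC_primitive l0 Pvk).
(* Both [v k] and [k] have integral zero, the first by hypothesis and the second by the choice of
   [m]; hence so does [(v - m) k], which is [t (v - m)^2]. *)
have Qq := primitiveB Pvk (primitiveZ m Pk).
have qE s : v s * k s - m * (t s * v s - m * t s) = t s * (v s - m) ^+ 2.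
  by rewrite /k; ring.
have vm s : a < s < b -> v s = m.
  move=> sab; have /andP[as_ sb] := sab.
  have : t s * (v s - m) ^+ 2 = 0.
    rewrite -qE; apply: (primitive_ge0_eq0 Qq).
    - by move=> r _; rewrite qE mulr_ge0 // sqr_ge0.
    - by apply/eqP; rewrite -subr_eq0 -[P l](subrK (P 0)) Pl0 /m; apply/eqP; field.
    - by rewrite (lt_trans a0) //= (lt_trans sb).
  by move=> /eqP; rewrite mulf_eq0 gt_eqF ?t_gt0 //= sqrf_eq0 subr_eq0 => /eqP.
by rewrite !vm ?ax ?ay ?xb ?yb.
Qed.

(** For an antiderivative [G] of [g], the functions [u] and [G] have the same integral against every
    [phi']. By du Bois-Reymond [u - G] is constant inside, so [u] inherits the derivative of [G]. *)
Lemma weak_derivative_primitive l u g : 0 < l ->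
  {within `[0, l], continuous u} -> {within `[0, l], continuous g} ->
  weak_derivative l u g -> primitive_on l u g.
Proof.
move=> l0 cu cg ug; have [G Gg] := primitive_exists l0 cg.
have [cG _ dG] := Gg.
have cv : {within `[0, l], continuous (fun x => u x - G x)}.
  by move=> x; apply: cvgB; [exact: cu|exact: cG].
have vcst x : 0 < x < l -> u x - G x = u (l / 2) - G (l / 2).
  move=> xl; apply: (weak_derivative0_cst l0 cv) => //; last by lra.
  move=> phi tphi; have [_ cphi' _] := test_fun_primitive tphi.
  have cup := within_continuousM cu cphi'.
  have cGp := within_continuousM cG cphi'.
  under eq_Rintegral do rewrite mulrBl.
  rewrite Rintegral_oo_cc; last first.
    by move=> y; apply: cvgB; [exact: cup|exact: cGp].
  rewrite RintegralB //; [|exact: continuous_integrable..].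
  rewrite -!Rintegral_oo_cc // (ug _ tphi).
  by rewrite (primitive_weak_derivative l0 Gg tphi) subrr.
split => // x xl.
have d : is_derive x 1 (G + cst (u (l / 2) - G (l / 2))) (g x).
  by have ? := dG _ xl; apply: is_derive_eq; rewrite addr0.
apply: near_eq_is_derive d; apply: filterS (near_itvoo xl) => y yl.
by rewrite !fctE -(vcst _ yl) addrC subrK.
Qed.

End WeakDerivative.

(** * The flux nonlinearity of the p-Laplacian *)

Section Flux.
Import numFieldNormedType.Exports.
Local Open Scope classical_set_scope.
Set Implicit Arguments.
Unset Strict Implicit.
Unset Printing Implicit Defensive.
Variables (R : realType) (p : R).
Hypothesis p_gt1 : 1 < p.
Implicit Types (x y k l : R) (u g : R -> R).

Definition flux y : R := `|y| `^ (p - 2) * y.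

Lemma fluxE y : 0 <= y -> flux y = y `^ (p - 1).
Proof.
move=> y0; rewrite /flux ger0_norm // mulrC (_ : p - 2 = (p - 1) - 1); last by ring.
by rewrite mulr_powRB1 // subr_gt0.
Qed.

Lemma fluxN y : flux (- y) = - flux y.
Proof. by rewrite /flux normrN mulrN. Qed.

Lemma flux0 : flux 0 = 0.
Proof. by rewrite /flux mulr0. Qed.

Lemma normr_flux y : `|flux y| = `|y| `^ (p - 1).
Proof. by rewrite -fluxE // /flux normrM normr_id [`|_ `^ _|]ger0_norm ?powR_ge0. Qed.

Lemma flux_mulr_ge0 y : 0 <= flux y * y.
Proof. by rewrite /flux -mulrA mulr_ge0 ?powR_ge0 // -expr2 sqr_ge0. Qed.

Lemma flux_mulr y : flux y * y = `|y| `^ p.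
Proof.
rewrite -[LHS]ger0_norm ?flux_mulr_ge0 // normrM normr_flux mulrC.
by rewrite mulr_powRB1 // (lt_trans ltr01).
Qed.

Lemma fluxM k y : 0 <= k -> flux (k * y) = k `^ (p - 1) * flux y.
Proof.
move=> k0; rewrite -fluxE // /flux normrM powRM //; ring.
Qed.

Lemma flux_lt x y : x < y -> flux x < flux y.
Proof.
have pos a b : 0 <= a -> a < b -> flux a < flux b.
  move=> a0 ab; have b0 := le_lt_trans a0 ab.
  by rewrite !fluxE ?(ltW b0) // gt0_ltr_powR ?subr_gt0 // nnegrE // ltW.
move=> xy; have [x0|x0] := leP 0 x; first exact: pos.
have [y0|y0] := leP y 0.
  by rewrite -ltrN2 -!fluxN pos ?ltrN2 // oppr_ge0.
apply: (@lt_trans _ _ 0); last by rewrite -flux0 pos.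
by rewrite -oppr_gt0 -fluxN -flux0 pos // oppr_gt0.
Qed.

Lemma flux_inj : injective flux.
Proof.
by move=> x y; case: (ltgtP x y) => // /flux_lt + e; rewrite e ltxx.
Qed.

(** The two factors have the same sign, [flux] being increasing. This gives the sign of each edge
    term in the uniqueness argument. *)
Lemma flux_monotone x y : 0 <= (flux x - flux y) * (x - y).
Proof.
case: (ltgtP x y) => [xy|yx|->]; last by rewrite !subrr mulr0.
  by rewrite mulr_le0 // subr_le0 ltW // flux_lt.
by rewrite mulr_ge0 // subr_ge0 ltW // flux_lt.
Qed.

(** For [p < 2] the factor [|y|^(p-2)] blows up near 0, so continuity is not that of a product.
    Positive points use [y^(p-1)], negative ones oddness, and 0 the bound [|flux y| = |y|^(p-1)]. *)
Lemma continuous_flux : continuous flux.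
Proof.
have pos y : 0 < y -> {for y, continuous flux}.
  move=> y0; have yI : y \in `]0, +oo[%R by rewrite in_itv /= y0.
  have dy : derivable (fun z : R => z `^ (p - 1)) y 1 by exact: derivable_powR.
  apply: differentiable_continuous; apply/derivable1_diffP.
  apply: near_eq_derivable dy.
  have yy : 0 < y < y + 1 by rewrite y0 ltrDl ltr01.
  by apply: filterS (near_itvoo yy) => z /andP[z0 _]; rewrite fluxE // ltW.
move=> y; have [y0|y0|->] := ltgtP y 0; last 1 first.
- rewrite /continuous_at flux0; apply/cvgr0Pnorm_lt => e e0.
  pose d := e `^ (p - 1)^-1.
  have d0 : - d < 0 < d by rewrite oppr_lt0 powR_gt0.
  apply: filterS (near_itvoo d0) => z; rewrite -ltr_norml normr_flux => zd.
  have -> : e = d `^ (p - 1).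
    by rewrite /d -powRrM mulVf ?powRr1 ?ltW // gt_eqF // subr_gt0.
  by rewrite gt0_ltr_powR ?subr_gt0 // nnegrE ?powR_ge0.
- have -> : flux = -%R \o (flux \o -%R).
    by apply/funext => z; rewrite /= fluxN opprK.
  apply: continuous_comp; last exact: opp_continuous.
  by apply: continuous_comp; [exact: opp_continuous|apply: pos; rewrite oppr_gt0].
- exact: pos.
Qed.

Lemma within_continuous_flux l g : {within `[0, l], continuous g} ->
  {within `[0, l], continuous (fun x => flux (g x))}.
Proof. by move=> cg x; apply: (continuous_comp (cg x)); exact: continuous_flux. Qed.

Lemma continuous_in_Lp l u : {within `[0, l], continuous u} -> in_Lp p l u.
Proof.
move=> cu; have cup : {within `[0, l], continuous (fun x => `|u x| `^ p)}.
  (* Written as [flux u * u], the power [|u|^p] gets its continuity from that of [flux]. *)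
  move=> x; rewrite (_ : (fun _ => _) = (fun x => flux (u x) * u x)).
    by apply: cvgM; [exact: within_continuous_flux|exact: cu].
  by apply/funext => y; rewrite flux_mulr.
split.
  have /measurable_int/measurable_EFinP := continuous_integrable cu.
  by apply: measurable_funS => //; exact: subset_itv_oo_cc.
by apply: integrableS (continuous_integrable cup) => //; exact: subset_itv_oo_cc.
Qed.

Lemma primitive_W1p_itv l u g : 0 < l -> primitive_on l u g -> W1p_itv p l u.
Proof.
move=> l0 ug; have [cu cg _] := ug; split; first exact: continuous_in_Lp.
exists g; split; first exact: continuous_in_Lp.
exact: primitive_weak_derivative.
Qed.

End Flux.

(** * Torsion functions in classical form: uniqueness, sign and scaling *)

Section TorsionFunctions.
Import numFieldNormedType.Exports.
Local Open Scope classical_set_scope.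
Set Implicit Arguments.
Unset Strict Implicit.
Unset Printing Implicit Defensive.
Variable R : realType.
Implicit Types (G : metric_graph R) (p : R).

Notation mu := (@lebesgue_measure R).

(** Regroup the ends by vertex: outside [VD] the common value of [D] factors out of a Kirchhoff sum,
    and on [VD] the factor [D] is zero. It disposes of the boundary terms when an equation is tested
    with [D]. *)
Lemma sum_ends G (VD : {set vert G}) (phi D : edge G * bool -> R) :
  (forall v, v \notin VD -> \sum_(h in ends_at v) phi h = 0) ->
  (forall h k, end_vert h = end_vert k -> D h = D k) ->
  (forall v, v \in VD -> forall h, h \in ends_at v -> D h = 0) ->
  \sum_e (phi (e, false) * D (e, false) + phi (e, true) * D (e, true)) = 0.
Proof.
move=> phi0 D_vert D0.
transitivity (\sum_(h : edge G * bool) phi h * D h).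
  transitivity (\sum_e \sum_b phi (e, b) * D (e, b)).
    by apply: eq_bigr => e _; rewrite big_bool addrC.
  by rewrite pair_bigA; apply: eq_bigr => -[].
rewrite (partition_big (@end_vert R G) xpredT) //= big1 // => v _.
have [vD|vND] := boolP (v \in VD).
  rewrite big1 // => h hv; rewrite (D0 v) ?mulr0 //.
  by rewrite inE.
case: (pickP (mem (ends_at v))) => [k kv|noend]; last first.
  by rewrite big1 // => h hv; have := noend h; rewrite /= inE hv.
rewrite (eq_bigr (fun h => phi h * D k)) => [|h /eqP hv]; last first.
  by congr (_ * _); apply: D_vert; move: kv; rewrite !inE hv => /eqP ->.
rewrite -mulr_suml (_ : \sum_(h | _) phi h = 0) ?mul0r //.
by rewrite -[RHS](phi0 v vND); apply: eq_bigl => h; rewrite inE.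
Qed.

(** The sign that turns the derivative in the edge coordinate into the outward one. *)
Definition end_sign G (h : edge G * bool) : R := if h.2 then -1 else 1.

Definition smooth_torsion G (VD : {set vert G}) p (w g : edge G -> R -> R) :=
  [/\ forall e, primitive_on (len e) (w e) (g e),
      forall e, primitive_on (len e) (fun x => flux p (g e x)) (fun=> -1),
      forall h k : edge G * bool, end_vert h = end_vert k ->
        w h.1 (end_pos h) = w k.1 (end_pos k),
      forall v, v \in VD -> forall h, h \in ends_at v -> w h.1 (end_pos h) = 0 &
      forall v, v \notin VD ->
        \sum_(h in ends_at v) end_sign h * flux p (g h.1 (end_pos h)) = 0].

(** Continuity of [g] and of [flux g] upgrades both weak equations to classical ones. Conversely,
    continuous functions on a compact edge are in L^p, so the Sobolev conditions come for free. *)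
Lemma is_torsion_functionP G (VD : {set vert G}) p w : 1 < p ->
  is_torsion_function VD p w <-> exists g, smooth_torsion VD p w g.
Proof.
move=> p1.
have kirchhoff (g : edge G -> R -> R) h :
    `|g h.1 (end_pos h)| `^ (p - 2) * outward_derivative g h =
    end_sign h * flux p (g h.1 (end_pos h)).
  by rewrite /outward_derivative /end_sign /flux; case: ifP => _; ring.
split=> [[[[_ cw glue] dir] [g [cg wg fg kir]]]|[g [wg fg glue dir kir]]].
  exists g; split => // [e|e|v vD].
  - by apply: weak_derivative_primitive => //; exact: len_gt0.
  - apply: weak_derivative_primitive => //; first exact: len_gt0.
      exact: within_continuous_flux.
    by move=> x; exact: cvg_cst.
  - by rewrite -[RHS](kir _ vD); apply: eq_bigr => h _; rewrite kirchhoff.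
split; first split => //.
  split => // [e|e]; first by apply: primitive_W1p_itv (wg e) => //; exact: len_gt0.
  by case: (wg e).
exists g; split => [e|e|e|v vD].
- by case: (wg e).
- by apply: primitive_weak_derivative => //; exact: len_gt0.
- by apply: primitive_weak_derivative => //; exact: len_gt0.
- by rewrite -[RHS](kir _ vD); apply: eq_bigr => h _; rewrite kirchhoff.
Qed.

Lemma smooth_torsion_unique G (VD : {set vert G}) p w1 w2 g1 g2 :
  connected_graph G -> VD != finset.set0 -> 1 < p ->
  smooth_torsion VD p w1 g1 -> smooth_torsion VD p w2 g2 ->
  forall e x, 0 <= x <= len e -> w1 e x = w2 e x.
Proof.
move=> Gconn VD0 p1 [wg1 fg1 glue1 dir1 kir1] [wg2 fg2 glue2 dir2 kir2].
pose a e := flux p (g1 e 0) - flux p (g2 e 0).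
pose D e x := w1 e x - w2 e x.
have aE e x : 0 <= x <= len e -> flux p (g1 e x) - flux p (g2 e x) = a e.
  move=> xe; have := primitive0_cst (primitiveB (fg1 e) (fg2 e)).
  by apply => // y _; rewrite subrr.
have endE (h : edge G * bool) : 0 <= end_pos h <= len h.1.
  by rewrite /end_pos; case: ifP => _; rewrite lexx ?andbT /= ltW ?len_gt0.
have glueD (h k : edge G * bool) : end_vert h = end_vert k ->
    D h.1 (end_pos h) = D k.1 (end_pos k).
  by move=> hk; rewrite /D (glue1 _ _ hk) (glue2 _ _ hk).
have dirD v : v \in VD -> forall h, h \in ends_at v -> D h.1 (end_pos h) = 0.
  by move=> vD h hv; rewrite /D (dir1 _ vD _ hv) (dir2 _ vD _ hv) subrr.
have MVT e : exists2 z, 0 <= z <= len e &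
    D e (len e) - D e 0 = (g1 e z - g2 e z) * len e.
  have [z /andP[z0 ze]] := primitive_MVT (primitiveB (wg1 e) (wg2 e)) (lexx 0)
    (len_gt0 e) (lexx _).
  by rewrite subr0; exists z; rewrite ?(ltW z0) ?(ltW ze).
(* As [a e] is the flux difference at every point of the edge, it can be read at the mean value
   point [z], where monotonicity of the flux applies. *)
have term_ge0 e : 0 <= a e * (D e (len e) - D e 0).
  have [z ze ->] := MVT e.
  rewrite -(aE _ _ ze) mulrA mulr_ge0 ?flux_monotone //.
  exact/ltW/len_gt0.
have sum0 : \sum_e a e * (D e (len e) - D e 0) = 0.
  have : \sum_e (end_sign (e, false) * a e * D e 0 +
                 end_sign (e, true) * a e * D e (len e)) = 0.
    apply: (@sum_ends G VD (fun h => end_sign h * a h.1)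
      (fun h => D h.1 (end_pos h))) => // v vD.
    under eq_bigr => h _ do rewrite -(aE _ _ (endE h)) mulrBr.
    by rewrite sumrB (kir1 _ vD) (kir2 _ vD) subrr.
  move=> sum_ends0; apply/eqP; rewrite -oppr_eq0 -sumrN; apply/eqP.
  by rewrite -[RHS]sum_ends0; apply: eq_bigr => e _; rewrite /end_sign /=; ring.
(* If the increment is the vanishing factor, then [g1] and [g2] agree at [z], and so do their
   fluxes. *)
have a0 e : a e = 0.
  have /eqP := sum0; rewrite psumr_eq0 => [/allP /(_ e)|//].
  rewrite mem_index_enum => /(_ isT) /=.
  have [z ze ->] := MVT e.
  rewrite !mulf_eq0 [len e == 0]gt_eqF ?len_gt0 // orbF => /orP[/eqP //|].
  by rewrite subr_eq0 -(aE _ _ ze) => /eqP ->; rewrite subrr.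
have gE e x : 0 < x < len e -> g1 e x - g2 e x = 0.
  move=> /andP[x0 xe]; apply/eqP; rewrite subr_eq0; apply/eqP.
  apply: (flux_inj p1); apply/eqP; rewrite -subr_eq0.
  by rewrite aE ?a0 // (ltW x0) (ltW xe).
have Dcst e x : 0 <= x <= len e -> D e x = D e 0.
  by apply: (primitive0_cst (primitiveB (wg1 e) (wg2 e))) => y; exact: gE.
pose zero v := forall h, h \in ends_at v -> D h.1 (end_pos h) = 0.
have zero_adj v v' : adj v v' -> zero v -> zero v'.
  move=> /existsP[e ends] zv h; rewrite inE => /eqP hv'.
  have De (b b' : bool) : D e (end_pos (e, b)) = D e (end_pos (e, b')).
    by rewrite (Dcst e) ?(endE (e, b)) // (Dcst e (end_pos (e, b'))) ?(endE (e, b')).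
  (* Adjacency ignores orientation; [b] records which end of [e] sits at [v]. *)
  have [b [bv bv']] : exists b, end_vert (e, b) = v /\ end_vert (e, ~~ b) = v'.
    by case/orP: ends => /andP[/eqP sv /eqP tv]; [exists false|exists true].
  rewrite (glueD h (e, ~~ b)) ?hv' //= (De _ b).
  by apply: (zv (e, b)); rewrite inE bv.
have zero_all v : zero v.
  have /set0Pn[v0 v0D] := VD0.
  have /connectP[q path_q ->] := Gconn v0 v.
  have : zero v0 by exact: dirD.
  elim: q v0 path_q {v0D} => //= v1 q IH v0 /andP[/zero_adj h pq] z0.
  by apply: IH pq _; exact: h.
move=> e x xe; apply/eqP; rewrite -subr_eq0; apply/eqP.
rewrite [LHS](Dcst e x) //.
by apply: (zero_all (src e) (e, false)); rewrite inE.
Qed.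

(* Testing the equation with [w] itself: [\int w = \int |w'|^p].  The sign is
   essential, as [x `^ r = 1] for negative [x]. *)
Lemma smooth_torsion_integral_ge0 G (VD : {set vert G}) p w g : 1 < p ->
  smooth_torsion VD p w g -> 0 <= graph_integral w.
Proof.
move=> p1 [wg fg glue dir kir].
have := @sum_ends G VD (fun h => end_sign h * flux p (g h.1 (end_pos h)))
  (fun h => w h.1 (end_pos h)) kir glue dir.
(* The bound 0 is replaced by the vanishing sum of boundary terms, so that the inequality can be
   proved edge by edge. *)
rewrite /end_sign /end_pos /= => <-; apply: ler_sum => e _.
have l0 := len_gt0 e; have [cw _ _] := wg e.
have [W Ww] := primitive_exists l0 cw.
rewrite (FTC_primitive l0 Ww).
(* The derivative of [flux(g) w + W] is [flux(g) g], as the two terms in [w] cancel. *)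
have Q := primitiveD (primitiveM (fg e) (wg e)) Ww.
have [z _] := primitive_MVT Q (lexx 0) l0 (lexx _).
have : 0 <= flux p (g e z) * g e z * (len e - 0).
  by rewrite subr0 mulr_ge0 ?flux_mulr_ge0 // ltW.
lra.
Qed.

(** The flux is homogeneous of degree [p - 1], so the factor [c^(1/(p-1))] on [g] multiplies it by
    [c], offsetting the [1/c] of the chain rule. Two length functions related by an equation allow
    the factor [c^-1] to lead back to the original graph itself. *)
Lemma smooth_torsion_scale (V E : finType) (s t : E -> V) (l1 l2 : E -> R)
    (l1_gt0 : forall e, 0 < l1 e) (l2_gt0 : forall e, 0 < l2 e)
    (VD : {set V}) p c w g : 1 < p -> 0 < c -> (forall e, l2 e = c * l1 e) ->
  smooth_torsion (G := MetricGraph s t l1_gt0) VD p w g ->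
  smooth_torsion (G := MetricGraph s t l2_gt0) VD p
    (fun e x => c `^ (p - 1)^-1 * c * w e (x / c))
    (fun e x => c `^ (p - 1)^-1 * g e (x / c)).
Proof.
move=> p1 c0 l2E [wg fg glue dir kir].
have cn0 : c != 0 by rewrite gt_eqF.
have fluxE e x : flux p (c `^ (p - 1)^-1 * g e (x / c)) = c * flux p (g e (x / c)).
  rewrite fluxM ?powR_ge0 // -powRrM mulVf ?powRr1 // ?ltW //.
  by rewrite gt_eqF // subr_gt0.
have posE (h : E * bool) : end_pos (G := MetricGraph s t l2_gt0) h / c =
    end_pos (G := MetricGraph s t l1_gt0) h.
  by rewrite /end_pos /=; case: ifP => _; rewrite ?mul0r // l2E mulrAC mulfV ?mul1r.
split => /=.
- move=> e; rewrite l2E.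
  have := primitiveZ (c `^ (p - 1)^-1 * c) (primitive_scale (l1_gt0 e) c0 (wg e)).
  congr primitive_on; apply/funext => x.
  by rewrite -mulrA [c * _]mulrCA mulfV ?mulr1.
- move=> e; rewrite l2E.
  have := primitiveZ c (primitive_scale (l1_gt0 e) c0 (fg e)).
  congr primitive_on; apply/funext => x; first by rewrite fluxE.
  by rewrite mulrCA mulfV ?mulr1.
- by move=> h k hk; rewrite !posE (glue h k hk).
- by move=> v vD h hv; rewrite posE (dir v vD h hv) mulr0.
- move=> v vD; rewrite -[RHS](mulr0 c) -[X in _ = c * X](kir v vD) mulr_sumr.
  by apply: eq_bigr => h _; rewrite fluxE posE; exact: mulrCA.
Qed.

Lemma torsion_functionP G (VD : {set vert G}) p w : 1 < p ->
  is_torsion_function VD p w ->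
  exists g, smooth_torsion VD p (torsion_function VD p) g.
Proof.
by move=> p1 tw; apply/is_torsion_functionP => //; exact: (xgetPex _ (ex_intro _ w tw)).
Qed.

End TorsionFunctions.

(** * Scaling of the integral and of the rigidity *)

Section Scaling.
Import numFieldNormedType.Exports.
Local Open Scope classical_set_scope.
Set Implicit Arguments.
Unset Strict Implicit.
Unset Printing Implicit Defensive.
Variable R : realType.
Implicit Types (G : metric_graph R) (p c : R).

(** By uniqueness the chosen torsion function agrees with [w] on the closed edges, which is all that
    the integral sees. *)
Lemma torsional_rigidityE G (VD : {set vert G}) p w g :
  connected_graph G -> VD != finset.set0 -> 1 < p -> smooth_torsion VD p w g ->
  torsional_rigidity VD p = graph_integral w `^ (p - 1).
Proof.
move=> Gconn VD0 p1 wg.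
have tw : is_torsion_function VD p w by apply/is_torsion_functionP => //; exists g.
have [g' wg'] := torsion_functionP p1 tw.
congr (_ `^ _); apply: eq_bigr => e _; apply: eq_Rintegral => x.
rewrite inE /= in_itv /= => xe.
exact: (smooth_torsion_unique Gconn VD0 p1 wg' wg).
Qed.

(** The default of [xget] is the zero function, and the power of its integral is 0 because [p - 1]
    is nonzero. *)
Lemma torsional_rigidity_none G (VD : {set vert G}) p : 1 < p ->
  ~ (exists w g, smooth_torsion VD p w g) -> torsional_rigidity VD p = 0.
Proof.
move=> p1 none; rewrite /torsional_rigidity /torsion_function xgetPN; last first.
  by move=> w tw; apply: none; exists w; apply/is_torsion_functionP.
rewrite /graph_integral big1 => [|e _]; last by rewrite Rintegral_cst // mul0r.
by rewrite powR0 // gt_eqF // subr_gt0.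
Qed.

Lemma smooth_torsion_scale_graph G (VD : {set vert G}) p c (c_gt0 : 0 < c) w g :
  1 < p -> smooth_torsion VD p w g ->
  smooth_torsion (G := scale_graph c_gt0 G) VD p
    (fun e x => c `^ (p - 1)^-1 * c * w e (x / c))
    (fun e x => c `^ (p - 1)^-1 * g e (x / c)).
Proof. by case: G VD w g => V E s t l l_gt0 VD w g p1; exact: smooth_torsion_scale. Qed.

Lemma smooth_torsion_unscale_graph G (VD : {set vert G}) p c (c_gt0 : 0 < c) w g :
  1 < p -> smooth_torsion (G := scale_graph c_gt0 G) VD p w g ->
  exists w' g', smooth_torsion VD p w' g'.
Proof.
case: G VD w g => V E s t l l_gt0 VD w g p1 wg; do 2 eexists.
apply: (smooth_torsion_scale (c := c^-1) _ p1 _ _ wg); first by rewrite invr_gt0.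
by move=> e /=; rewrite mulrA mulVf ?mul1r // gt_eqF.
Qed.

(** Change of variables through antiderivatives: if [W' = w], then [k c W(x/c)] has derivative
    [k w(x/c)]. *)
Lemma graph_integral_scale G c (c_gt0 : 0 < c) (w : edge G -> R -> R) k :
  (forall e, {within `[0, len e], continuous (w e)}) ->
  graph_integral (G := scale_graph c_gt0 G) (fun e x => k * w e (x / c)) =
  k * c * graph_integral w.
Proof.
move=> cw; rewrite /graph_integral mulr_sumr; apply: eq_bigr => e _ /=.
have l0 : 0 < @len R G e by exact: len_gt0.
have [W Ww] := primitive_exists l0 (cw e).
have cl0 : 0 < c * @len R G e by rewrite mulr_gt0.
have := primitiveZ (k * c) (primitive_scale l0 c_gt0 Ww).
have -> : (fun x => k * c * (w e (x / c) / c)) = (fun x => k * w e (x / c)).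
  by apply/funext => x; rewrite -mulrA [c * _]mulrCA mulfV ?mulr1 // gt_eqF.
move=> /(FTC_primitive cl0) ->; rewrite (FTC_primitive l0 Ww) mul0r -mulrBr.
by congr (_ * (W _ - _)); rewrite mulrAC mulfV ?mul1r // gt_eqF.
Qed.

End Scaling.

Theorem lemma3p6 (R : realType) (G : metric_graph R) (VD : {set vert G})
    (p c : R) (G_conn : connected_graph G) (VD_neq0 : VD != finset.set0)
    (VD_deg1 : forall v, v \in VD -> deg v = 1%N)
    (p_gt1 : 1 < p) (c_gt0 : 0 < c) :
  torsional_rigidity (G := scale_graph c_gt0 G) VD p =
  c `^ (2 * p - 1) * torsional_rigidity VD p.
Proof.
have [[w [g wg]]|none] := pselect (exists w g, smooth_torsion VD p w g); last first.
  rewrite !torsional_rigidity_none ?mulr0 // => -[w [g wg]].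
  exact: none (smooth_torsion_unscale_graph p_gt1 wg).
have wg' := smooth_torsion_scale_graph c_gt0 p_gt1 wg.
rewrite (torsional_rigidityE _ _ p_gt1 wg') // (torsional_rigidityE _ _ p_gt1 wg) //.
rewrite graph_integral_scale; last by case: wg => wg _ _ _ _ e; case: (wg e).
(* A real power distributes over a product only for nonnegative factors, hence the sign of the
   integral. *)
have c0 := ltW c_gt0; have I0 := smooth_torsion_integral_ge0 p_gt1 wg.
rewrite powRM ?mulr_ge0 ?powR_ge0 // !powRM ?mulr_ge0 ?powR_ge0 //.
have pn0 : p - 1 != 0 by rewrite gt_eqF // subr_gt0.
rewrite -powRrM mulVf // powRr1 //; congr (_ * _).
(* The summand 1 comes from [c^(1/(p-1))], one [p - 1] from the other factor [c] of the amplitude,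
   and one from the change of variables. *)
rewrite (_ : 2 * p - 1 = 1 + (p - 1) + (p - 1)); last by ring.
by rewrite !powRD ?powRr1 // (gt_eqF c_gt0) implybT.
Qed.
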